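(* Let $\mathcal{C}_6^1=\langle (x+1)^\alpha,\ u^2(x+1)^\omega\rangle\subseteq\mathcal{S}$, where $0\le\omega<\mathcal{V}\le\mathcal{U}\le\alpha\le2^\varsigma-1$. Then, for every trace orthogonal basis $\mathcal{B}$ of $\mathbb{F}_{2^m}$ over $\mathbb{F}_2$, $$d_L^{\mathcal{B}}(\mathcal{C}_6^1)=\begin{cases}2 & \text{if } 1\le\alpha\le2^{\varsigma-1},\\ 2 & \text{if } 2^{\varsigma-1}+1\le\alpha\le2^\varsigma-1 \text{ with } \omega=0,\\ 4 & \text{if } 2^{\varsigma-1}+1\le\alpha\le2^\varsigma-1 \text{ with } 1\le\omega\le2^{\varsigma-1},\\ 2^{\gamma+1} & \text{if } 2^\varsigma-2^{\varsigma-\gamma}+1\le\omega<\alpha\le2^\varsigma-2^{\varsigma-\gamma}+2^{\varsigma-\gamma-1},\ \text{where } 1\le\gamma\le\varsigma-1.\end{cases}$$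
   Context: Let $m,\varsigma$ be positive integers, $\mathcal{R}=\mathbb{F}_{2^m}+u\mathbb{F}_{2^m}+u^2\mathbb{F}_{2^m}$ with $u^3=0$ (i.e. $\mathbb{F}_{2^m}[u]/\langle u^3\rangle$), and $\mathcal{S}=\mathcal{R}[x]/\langle x^{2^\varsigma}-1\rangle$. Cyclic codes of length $2^\varsigma$ over $\mathcal{R}$ are the ideals of $\mathcal{S}$; the class of $c_0+c_1x+\cdots+c_{2^\varsigma-1}x^{2^\varsigma-1}$ is identified with $(c_0,\dots,c_{2^\varsigma-1})\in\mathcal{R}^{2^\varsigma}$. $\langle\cdot\rangle$ denotes the ideal of $\mathcal{S}$ generated. A trace orthogonal basis (TOB) of $\mathbb{F}_{2^m}$ over $\mathbb{F}_2$ is a basis $\mathcal{B}=\{\zeta_1,\dots,\zeta_m\}$ with $Tr(\zeta_i\zeta_j)=1$ if $i=j$ and $0$ if $i\ne j$, where $Tr(y)=y+y^2+y^{2^2}+\cdots+y^{2^{m-1}}$ (such bases exist). For $y=\sum_i y_i\zeta_i\in\mathbb{F}_{2^m}$ with $y_i\in\mathbb{F}_2$, $wt_L^{\mathcal{B}}(y)$ is the number of $i$ with $y_i=1$. For $a+ub+u^2c\in\mathcal{R}$ ($a,b,c\in\mathbb{F}_{2^m}$), $wt_L^{\mathcal{B}}(a+ub+u^2c)=wt_L^{\mathcal{B}}(a+b+c)+wt_L^{\mathcal{B}}(b+c)+wt_L^{\mathcal{B}}(b)$. The Lee weight of a vector (or polynomial of degree less than $2^\varsigma$) is the sum of the Lee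 weights of its entries (coefficients). The Lee distance $d_L^{\mathcal{B}}(\mathcal{C})$ of a nonzero code $\mathcal{C}$ is the minimum Lee weight of its nonzero elements. $\mathcal{U}$ is the smallest nonnegative integer such that $u(x+1)^{\mathcal{U}}+u^2g(x)\in\langle(x+1)^\alpha\rangle$ for some $g(x)\in\mathcal{S}$, and $\mathcal{V}$ is the smallest nonnegative integer such that $u^2(x+1)^{\mathcal{V}}\in\langle(x+1)^\alpha\rangle$; explicitly $\mathcal{U}=\mathcal{V}=\alpha$. *)

(* Defs.v *)
From HB Require Import structures.
From mathcomp Require Import all_boot all_order all_algebra all_field.

Set Implicit Arguments.
Unset Strict Implicit.
Unset Printing Implicit Defensive.

Import GRing.Theory.
Local Open Scope ring_scope.

Definition is_least (P : nat -> Prop) (n : nat) : Prop :=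
  P n /\ forall k : nat, P k -> (n <= k)%N.

Definition ideal_gen (A : comNzRingType) (gs : seq A) (f : A) : Prop :=
  exists c : 'I_(size gs) -> A, f = \sum_(i < size gs) c i * gs`_i.

(* F + uF + u^2 F with u^3 = 0; the coefficients r`_0, r`_1, r`_2 of the
   reduced representative of r are the a, b, c of r = a + ub + u^2 c. *)
Definition chain_ring (F : fieldType) := {poly %/ ('X^3 : {poly F})}.

(* The elements of {poly %/ p} are the reduced representatives, so that c`_i,
   for i < 2 ^ s, are the entries of the codeword identified with c. *)
Definition cyclic_ring (F : fieldType) (s : nat) :=
  {poly %/ ('X^(2 ^ s) - 1 : {poly chain_ring F})}.

Definition cyc_u (F : fieldType) (s : nat) : cyclic_ring F s :=
  qpolyC _ ('qX : chain_ring F).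

Definition cyc_x (F : fieldType) (s : nat) : cyclic_ring F s := 'qX.

(* A field with 2 ^ m elements is taken as an extension of 'F_2 of dimension m,
   so that bases over 'F_2 and coordinates are those of the library. *)
Section LeeWeight.

Variables (m : nat) (F : fieldExtType 'F_2).

Definition trace2 (y : F) : F := \sum_(k < m) y ^+ (2 ^ k).

Definition trace_orthogonal_basis (b : m.-tuple F) : Prop :=
  basis_of {:F} b /\
  forall i j : 'I_m, trace2 (tnth b i * tnth b j) = (i == j)%:R.

Definition lee_weight_field (b : m.-tuple F) (y : F) : nat :=
  #|[set i : 'I_m | coord b i y == 1]|.

Definition lee_weight_ring (b : m.-tuple F) (r : chain_ring F) : nat :=
  (lee_weight_field b (r`_0 + r`_1 + r`_2)
   + lee_weight_field b (r`_1 + r`_2)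
   + lee_weight_field b r`_1)%N.

Definition lee_weight (s : nat) (b : m.-tuple F) (c : cyclic_ring F s) : nat :=
  (\sum_(i < 2 ^ s) lee_weight_ring b (c`_i)%R)%N.

Definition is_lee_distance (s : nat) (b : m.-tuple F)
    (C : cyclic_ring F s -> Prop) (d : nat) : Prop :=
  is_least (fun w => exists c : cyclic_ring F s,
                       [/\ C c, c != 0 & w = lee_weight b c]) d.

End LeeWeight.

Section Torsion.

Variables (F : fieldType) (s alpha : nat).
Let x := cyc_x F s.
Let u := cyc_u F s.

Definition is_U : nat -> Prop :=
  is_least (fun n => exists g : cyclic_ring F s,
    ideal_gen [:: (x + 1) ^+ alpha] (u * (x + 1) ^+ n + u ^+ 2 * g)).

Definition is_V : nat -> Prop :=
  is_least (fun n => ideal_gen [:: (x + 1) ^+ alpha] (u ^+ 2 * (x + 1) ^+ n)).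

Definition code_C61 (omega : nat) : cyclic_ring F s -> Prop :=
  ideal_gen [:: (x + 1) ^+ alpha; u ^+ 2 * (x + 1) ^+ omega].

End Torsion.

Arguments code_C61 : clear implicits.

(* Main.v *)
(** In characteristic 2, X^(2^s) - 1 = (X + 1)^(2^s), so a codeword
  a + u b + u^2 c has a and b divisible by (X + 1)^alpha and c divisible by
  (X + 1)^omega. Its Lee weight adds those of a + b + c, b + c and b; it is at
  least the Hamming weight of b, at least that of a = (a + b + c) - (b + c),
  and, when a = b = 0, at least twice that of c. The lower bounds follow from
  those on the Hamming weight of multiples of (X + 1)^i. They are attained at
  zeta (X + 1)^M or u^2 zeta (X + 1)^M, with zeta in the basis and
  M = 2^s - 2^(s-k), for which (X + 1)^M is a product of k binomials
  X^(2^j) + 1. *)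
Require Import Defs.
From mathcomp Require Import all_boot all_order all_algebra all_field.

Set Implicit Arguments.
Unset Strict Implicit.
Unset Printing Implicit Defensive.

Import GRing.Theory.
Local Open Scope ring_scope.

(** * Powers of X + 1 and binomial coefficients *)

Section CommutativeRing.

Variable A : comNzRingType.

Lemma coef_X1exp (M i : nat) : (('X + 1 : {poly A}) ^+ M)`_i = 'C(M, i)%:R.
Proof.
elim: M i => [|M IH] i; first by rewrite expr0 coef1 bin0n.
rewrite exprSr mulrDr mulr1 coefD coefMX !IH.
by case: i => [|i] /=; rewrite ?bin0 ?add0r // binS natrD addrC.
Qed.

Lemma size_X1exp (M : nat) : size (('X + 1 : {poly A}) ^+ M) = M.+1.
Proof.
apply/eqP; rewrite eqn_leq ltnNge; apply/andP; split.
  by apply/leq_sizeP => i Mi; rewrite coef_X1exp bin_small.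
apply/negP => /leq_sizeP/(_ M (leqnn M))/eqP.
by rewrite coef_X1exp binn oner_eq0.
Qed.

Lemma X1exp2 (t : nat) : 2 \in [pchar A] ->
  ('X + 1 : {poly A}) ^+ (2 ^ t) = 'X^(2 ^ t) + 1.
Proof.
move=> A2; have A2p : 2 \in [pchar {poly A}] by rewrite pchar_poly.
by rewrite exprDn_pchar ?expr1n // pnatX (pnatE [pchar {poly A}]) ?A2p.
Qed.

End CommutativeRing.

(** * Hamming weights of multiples of (X + 1)^i in characteristic 2 *)

Section HammingWeight.

Variable F : fieldType.
Hypothesis F2 : 2 \in [pchar F].

Definition hamming_weight (n : nat) (p : {poly F}) : nat :=
  \sum_(i < n) (p`_i != 0)%R.

Lemma hamming_weight_gt0 (n : nat) (p : {poly F}) :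
  p != 0 -> (size p <= n)%N -> (0 < hamming_weight n p)%N.
Proof.
move=> p0 sp; have sp0 : (0 < size p)%N by rewrite size_poly_gt0.
have ln : ((size p).-1 < n)%N by rewrite prednK.
rewrite /hamming_weight (bigD1 (Ordinal ln)) //= -/(lead_coef p).
by rewrite lead_coef_eq0 p0.
Qed.

(** As p has degree below n, the supports of p and X^n p are disjoint. *)
Lemma hamming_weight_double (n : nat) (p : {poly F}) : (size p <= n)%N ->
  hamming_weight (n + n) (('X^n + 1) * p) = (2 * hamming_weight n p)%N.
Proof.
move=> sp; rewrite /hamming_weight big_split_ord /= mul2n -addnn.
congr addn; apply: eq_bigr => i _; rewrite mulrDl mul1r coefD coefXnM.
  by rewrite ltn_ord add0r.
by rewrite ltnNge leq_addr /= addnC addnK [p`_(_ + n)]nth_default ?addr0 //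
  (leq_trans sp) // leq_addl.
Qed.

Lemma hamming_weight_X1exp (s k : nat) : (k <= s)%N ->
  hamming_weight (2 ^ s) (('X + 1) ^+ (2 ^ s - 2 ^ (s - k))) = (2 ^ k)%N.
Proof.
elim: s k => [|s IH] [|k] // ks.
- by rewrite /hamming_weight big_ord1 expr0 coef1 oner_eq0.
- rewrite subn0 subnn expr0 /hamming_weight -(prednK (expn_gt0 2 s.+1)).
  rewrite big_ord_recl big1 ?coef1 ?oner_eq0 // => i _.
  by rewrite coef1 /= eqxx.
- have le : (2 ^ (s - k) <= 2 ^ s)%N by rewrite leq_exp2l // leq_subr.
  (* The exponent is 2^s + (2^s - 2^(s-k)): the binomial X^(2^s) + 1 splits off and doubles the
     weight of the remaining power. *)
  rewrite subSS expnS mul2n -addnn -addnBA // exprD X1exp2 //.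
  rewrite hamming_weight_double ?IH ?expnS //.
  rewrite size_X1exp ltn_subrL expn_gt0 /=; exact: expn_gt0.
Qed.

(** A multiple of X + 1 vanishes at 1, whereas a single nonzero term takes its leading coefficient
    as value there. *)
Lemma hamming_weight_ge2 (n : nat) (f : {poly F}) : f != 0 -> (size f <= n)%N ->
  'X + 1 %| f -> (2 <= hamming_weight n f)%N.
Proof.
move=> f0 sf dv; have r1 : root f 1.
  rewrite -dvdp_XsubCl; suff -> : 'X - 1%:P = 'X + 1 :> {poly F} by [].
  by congr (_ + _); rewrite oppr_pchar2 // pchar_poly.
have ln : ((size f).-1 < n)%N by rewrite prednK // size_poly_gt0.
rewrite /hamming_weight (bigD1 (Ordinal ln)) //= -/(lead_coef f).
rewrite lead_coef_eq0 f0 ltnS lt0n; apply: contraTneq r1 => /eqP.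
rewrite sum_nat_eq0 => /forall_inP h.
rewrite /root (horner_coef_wide _ sf) (bigD1 (Ordinal ln)) //= big1 ?addr0.
  by rewrite expr1n mulr1 -/(lead_coef f) lead_coef_eq0.
by move=> i /h; rewrite eqb0 negbK => /eqP ->; rewrite mul0r.
Qed.

(* Write f = f0 + X^N f1 with N = 2 ^ s half the length, so that
   f = (f0 + f1) + (X + 1)^N f1; divisibility by (X + 1)^N forces f0 = f1. *)
Lemma hamming_weight_lower (s k i : nat) (f : {poly F}) : (k <= s)%N ->
  (2 ^ s - 2 ^ (s - k) < i)%N -> f != 0 -> (size f <= 2 ^ s)%N ->
  ('X + 1) ^+ i %| f -> (2 ^ k.+1 <= hamming_weight (2 ^ s) f)%N.
Proof.
elim: s k i f => [|s IH] [|k] i f // ks li f0 sf dv.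
(* For k = 0 the threshold is 0, so i is positive and X + 1 divides f. *)
1,2: apply: hamming_weight_ge2 => //; apply: dvdp_trans dv.
1,2: by rewrite -[X in X %| _]expr1 dvdp_exp2l // (leq_trans _ li).
set N := (2 ^ s)%N.
have sN : (2 ^ s.+1 = N + N)%N by rewrite expnS mul2n -addnn.
have le : (2 ^ (s - k) <= N)%N by rewrite leq_exp2l // leq_subr.
rewrite subSS sN -addnBA // in li.
pose f0' := take_poly N f; pose f1 := drop_poly N f.
have fE : f = (f0' + f1) + ('X + 1) ^+ N * f1.
  rewrite X1exp2 // mulrDl mul1r addrC -addrA [f1 + _]addrC -addrA.
  rewrite (addrr_pchar2 _ f1) ?pchar_poly // addr0 addrC mulrC.
  by rewrite -[LHS](poly_take_drop N).
have s1 : (size f1 <= N)%N by rewrite size_drop_poly leq_subLR -sN.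
have s0 : (size f0' <= N)%N by rewrite size_take_poly.
(* Since i > N, (X + 1)^N divides this sum, whose degree is below N. *)
have z : f0' + f1 = 0.
  have dN : ('X + 1) ^+ N %| f0' + f1.
    rewrite -(dvdp_addl (f0' + f1) (dvdp_mulIl _ f1)) -fE.
    apply: dvdp_trans dv; apply: dvdp_exp2l.
    by apply: leq_trans (ltnW li); apply: leq_addr.
  apply: contraTeq dN => nz; apply/negP => /(dvdp_leq nz); apply/negP.
  by rewrite -ltnNge size_X1exp ltnS (leq_trans (size_polyD _ _)) // geq_max s0.
rewrite z add0r in fE.
have f10 : f1 != 0 by apply: contraNneq f0; rewrite fE => ->; rewrite mulr0.
rewrite fE X1exp2 // sN hamming_weight_double // [(2 ^ _)%N]expnS leq_mul2l /=.
apply: (IH k (i - N)%N) => //.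
  by rewrite ltn_subRL.
have iN : (N <= i)%N by apply: leq_trans (ltnW li); apply: leq_addr.
move: dv; rewrite fE -{1}(subnKC iN) exprD dvdp_mul2l //.
by rewrite -size_poly_eq0 size_X1exp.
Qed.

End HammingWeight.

(** * Codewords as reduced polynomials, and their components over F *)

Section Codewords.

Variables (F : fieldType) (s : nat).
Hypothesis F2 : 2 \in [pchar F].

Local Notation R := (chain_ring F).
Local Notation u := ('qX : R).

Lemma pchar_chain_ring : 2 \in [pchar R].
Proof. by rewrite pchar_qpoly. Qed.

Lemma coef_in_qpolyXn (n k : nat) (p : {poly F}) : (k <= n)%N ->
  (in_qpoly 'X^(n.+1) p)`_k = p`_k.
Proof.
move=> kn; rewrite /= mk_monic_Xn.
rewrite [in RHS](Pdiv.RingMonic.rdivp_eq (monicXn F n.+1) p).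
by rewrite coefD coefMXn ltnS kn add0r.
Qed.

Lemma coef_chain_ringX2M (r : R) (k : nat) : (k < 3)%N ->
  (u ^+ 2 * r)`_k = if (k < 2)%N then 0 else r`_(k - 2).
Proof.
move=> k3; have -> : u ^+ 2 * r = in_qpoly 'X^3 ('X^2 * (r : {poly F})).
  rewrite in_qpolyM rmorphXn /=; congr (_ * _); apply: val_inj => /=.
  by rewrite Pdiv.CommonRing.rmodp_small // size_mk_monic.
by rewrite coef_in_qpolyXn // coefXnM.
Qed.

(** [mk_monic] would replace by X a modulus that is constant or not monic; this one is neither. *)
Lemma cyclic_modulusE :
  mk_monic ('X^(2 ^ s) - 1 : {poly R}) = 'X^(2 ^ s) - 1.
Proof.
rewrite /mk_monic size_XnsubC ?expn_gt0 // ltnS expn_gt0 /=.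
by rewrite monicXnsubC ?expn_gt0.
Qed.

Lemma size_codeword (c : cyclic_ring F s) : (size c <= 2 ^ s)%N.
Proof.
apply: leq_trans (size_npoly c) _.
by rewrite cyclic_modulusE size_XnsubC ?expn_gt0.
Qed.

(** For k = 0, 1, 2 these are the polynomials a, b, c of a + u b + u^2 c. *)
Definition component (k : nat) (p : {poly R}) : {poly F} :=
  map_poly (fun r : R => r`_k) p.

Lemma coef_component (k : nat) (p : {poly R}) (i : nat) :
  (component k p)`_i = (p`_i)`_k.
Proof. by rewrite coef_map_id0 //= coef0. Qed.

Lemma componentD (k : nat) (p q : {poly R}) :
  component k (p + q) = component k p + component k q.
Proof. by apply/polyP => i; rewrite coefD !coef_component coefD coefD. Qed.

(** Components are additive but not multiplicative in general; multiplying by X + 1 only shifts and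
    adds coefficients. *)
Lemma componentM_X1exp (k n : nat) (p : {poly R}) :
  component k (p * ('X + 1) ^+ n) = component k p * ('X + 1) ^+ n.
Proof.
elim: n => [|n IH]; first by rewrite [in LHS]expr0 [in RHS]expr0 !mulr1.
rewrite (exprSr ('X + 1 : {poly R})) (exprSr ('X + 1 : {poly F})).
rewrite !mulrA -IH !mulrDr !mulr1 componentD; congr (_ + _).
apply/polyP => i; rewrite coefMX !coef_component coefMX.
by case: i => [|i]; rewrite ?coef0.
Qed.

Lemma component_X2Z (k : nat) (p : {poly R}) : (k < 2)%N ->
  component k (u ^+ 2 *: p) = 0.
Proof.
move=> k2; apply/polyP => i.
by rewrite coef_component coefZ coef0 coef_chain_ringX2M ?k2 // ltnW.
Qed.

Local Notation modulus := ('X^(2 ^ s) - 1 : {poly R}).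

Lemma in_cyclic_ringK (c : cyclic_ring F s) :
  in_qpoly modulus (c : {poly R}) = c.
Proof.
by apply: val_inj; rewrite /= Pdiv.CommonRing.rmodp_small // size_mk_monic.
Qed.

Lemma cyc_x_add1X (n : nat) :
  (cyc_x F s + 1) ^+ n = in_qpoly modulus (('X + 1) ^+ n).
Proof. by rewrite rmorphXn rmorphD rmorph1. Qed.

Lemma cyc_uX (n : nat) : cyc_u F s ^+ n = in_qpoly modulus (u ^+ n)%:P.
Proof. by rewrite -rmorphXn -[LHS]in_cyclic_ringK. Qed.

Lemma in_cyclic_ringE (p : {poly R}) : exists q : {poly R},
  in_qpoly modulus p = p + q * ('X + 1) ^+ (2 ^ s) :> {poly R}.
Proof.
exists (- Pdiv.CommonRing.rdivp p modulus).
have -> : ('X + 1) ^+ (2 ^ s) = modulus.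
  have R2 := pchar_chain_ring.
  by rewrite X1exp2 // oppr_pchar2 // pchar_poly.
rewrite mulNr /= cyclic_modulusE.
have mon : modulus \is monic by rewrite monicXnsubC ?expn_gt0.
by rewrite {2}(Pdiv.RingMonic.rdivp_eq mon p) addrAC subrr add0r.
Qed.

(** An identity of representatives, not of classes, so that components can be read off. Reduction
    adds a multiple of (X + 1)^(2^s), absorbed by the first term as alpha is at most 2^s. *)
Lemma codeword_decomposition (alpha omega : nat) (c : cyclic_ring F s) :
  (alpha <= 2 ^ s)%N -> code_C61 F s alpha omega c ->
  exists p q : {poly R},
    c = p * ('X + 1) ^+ alpha + u ^+ 2 *: q * ('X + 1) ^+ omega :> {poly R}.
Proof.
move=> le_alpha [g]; rewrite big_ord_recl big_ord1 /=.
set g0 := g _; set g1 := g _.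
rewrite -(in_cyclic_ringK g0) -(in_cyclic_ringK g1) !cyc_x_add1X cyc_uX.
rewrite -(in_qpolyM _ (u ^+ 2)%:P) -!in_qpolyM -in_qpolyD => ->.
have [q qE] := in_cyclic_ringE
  ((g0 : {poly R}) * ('X + 1) ^+ alpha
   + (g1 : {poly R}) * ((u ^+ 2)%:P * ('X + 1) ^+ omega)).
exists ((g0 : {poly R}) + q * ('X + 1) ^+ (2 ^ s - alpha)), (g1 : {poly R}).
apply: etrans qE _.
rewrite mulrDl -mulrA -exprD subnK // addrAC; congr (_ + _ + _).
by rewrite mulrCA mulrA mul_polyC.
Qed.

(** Multiples of u^2 have zero components 0 and 1, so only the first generator contributes. *)
Lemma dvd_component (alpha omega k : nat) (c : cyclic_ring F s) :
  (alpha <= 2 ^ s)%N -> code_C61 F s alpha omega c ->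
  (k < 2)%N -> ('X + 1) ^+ alpha %| component k c.
Proof.
move=> le_alpha /(codeword_decomposition le_alpha) [p [q ->]] k2.
rewrite componentD !componentM_X1exp component_X2Z // mul0r addr0.
exact: dvdp_mulIr.
Qed.

Lemma dvd_component2 (alpha omega k : nat) (c : cyclic_ring F s) :
  (omega <= alpha <= 2 ^ s)%N -> code_C61 F s alpha omega c ->
  ('X + 1) ^+ omega %| component k c.
Proof.
move=> /andP[le_omega le_alpha] /(codeword_decomposition le_alpha) [p [q ->]].
rewrite componentD !componentM_X1exp dvdp_add ?dvdp_mulIr //.
by rewrite dvdp_mull // dvdp_exp2l.
Qed.

Lemma size_component (k : nat) (c : cyclic_ring F s) :
  (size (component k c) <= 2 ^ s)%N.
Proof. exact: leq_trans (size_poly _ _) (size_codeword c). Qed.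

Lemma component_eq0 (c : cyclic_ring F s) :
  component 0 c = 0 -> component 1 c = 0 -> component 2 c = 0 -> c = 0.
Proof.
move=> c0 c1 c2; apply/npolyP => i; rewrite coef0; apply/npolyP => k.
rewrite coef0 -coef_component.
case: k => [|[|[|k]]]; rewrite ?c0 ?c1 ?c2 ?coef0 //.
(* From index 3 on, elements reduced modulo X^3 have zero coefficients. *)
by rewrite coef_component big_coef_npoly // mk_monic_Xn size_polyXn.
Qed.

End Codewords.

(** * Lee weights, bounded and computed through Hamming weights *)

Section LeeDistance.

Variables (m : nat) (F : fieldExtType 'F_2) (b : m.-tuple F).
Hypothesis b_basis : basis_of {:F} b.

Lemma pchar_F2ext : 2 \in [pchar F].
Proof. by rewrite pchar_lalg pchar_Fp. Qed.

Lemma lee_weight_field0 : lee_weight_field b 0 = 0%N.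
Proof.
by apply: eq_card0 => i; rewrite inE linear0 eq_sym oner_eq0.
Qed.

Lemma lee_weight_field_gt0 (y : F) : y != 0 -> (0 < lee_weight_field b y)%N.
Proof.
move=> y0; rewrite card_gt0; apply: contraNneq y0 => wt0.
rewrite (coord_basis b_basis (memvf y)) big1 // => i _.
suff -> : coord b i y = 0 by rewrite scale0r.
have /setP/(_ i) := wt0; rewrite !inE.
by case: (coord b i y) => [[|[|n]] lt_n] //= _; apply: val_inj.
Qed.

Lemma lee_weight_field_basis (i : 'I_m) : lee_weight_field b b`_i = 1%N.
Proof.
apply: etrans (cards1 i); apply: eq_card => j; rewrite !inE.
by rewrite coord_free ?(basis_free b_basis) // (eq_sym i); case: (j == i).
Qed.

Lemma lee_weight_ring_ge (r : chain_ring F) (k : nat) : (k < 2)%N ->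
  ((r`_k != 0)%R <= lee_weight_ring b r)%N.
Proof.
move=> k2; case: eqP => //= /eqP rk; rewrite /lee_weight_ring.
case: k k2 rk => [|[|]] // _ rk; last first.
  by rewrite addnC ltn_addr // lee_weight_field_gt0.
(* For a nonzero: either b + c is nonzero, or a + b + c = a is. *)
have [e|e] := eqVneq (r`_1 + r`_2) 0; last first.
  by rewrite -addnA addnCA ltn_addr // lee_weight_field_gt0.
by rewrite -addnA ltn_addr // lee_weight_field_gt0 // -addrA e addr0.
Qed.

Lemma lee_weight_ring_ge2 (r : chain_ring F) : r`_0 = 0 -> r`_1 = 0 ->
  (2 * (r`_2 != 0)%R <= lee_weight_ring b r)%N.
Proof.
move=> r0 r1; rewrite /lee_weight_ring r0 r1 !add0r mul2n -addnn.
case: eqP => //= /eqP r2; apply: leq_trans (leq_addr _ _).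
by apply: leq_add; apply: lee_weight_field_gt0.
Qed.

(** If component 0 or 1 is nonzero, the bound for alpha applies; otherwise component 2 is nonzero
    and counts twice. The Hamming bounds stay hypotheses, to be supplied case by case. *)
Lemma lee_weight_lower (s alpha omega d : nat) (c : cyclic_ring F s) :
  (omega <= alpha <= 2 ^ s)%N ->
  (forall f : {poly F}, f != 0 -> (size f <= 2 ^ s)%N ->
     ('X + 1) ^+ alpha %| f -> (d <= hamming_weight (2 ^ s) f)%N) ->
  (forall f : {poly F}, f != 0 -> (size f <= 2 ^ s)%N ->
     ('X + 1) ^+ omega %| f -> (d <= 2 * hamming_weight (2 ^ s) f)%N) ->
  code_C61 F s alpha omega c -> c != 0 -> (d <= lee_weight b c)%N.
Proof.
move=> le_oa d_alpha d_omega cC c0.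
have [_ le_alpha] := andP le_oa.
have small k : (k < 2)%N -> component k c != 0 -> (d <= lee_weight b c)%N.
  move=> k2 ck; have := dvd_component pchar_F2ext le_alpha cC k2.
  move=> /(d_alpha _ ck (size_component k c))/leq_trans; apply.
  by apply: leq_sum => i _; rewrite coef_component lee_weight_ring_ge.
have [c00|] := eqVneq (component 0 c) 0; last exact: small.
have [c10|] := eqVneq (component 1 c) 0; last exact: small.
have c20 : component 2 c != 0.
  by apply: contraNneq c0 => c20; apply/eqP; apply: component_eq0.
have := dvd_component2 pchar_F2ext 2 le_oa cC.
move=> /(d_omega _ c20 (size_component 2 c))/leq_trans; apply.
rewrite big_distrr /=; apply: leq_sum => i _; rewrite coef_component.
by apply: lee_weight_ring_ge2; rewrite -coef_component ?c00 ?c10 coef0.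
Qed.

Lemma lee_weight_ring0 : lee_weight_ring b 0 = 0%N.
Proof. by rewrite /lee_weight_ring !coef0 !addr0 lee_weight_field0. Qed.

Lemma lee_weight0 (s : nat) : lee_weight b (0 : cyclic_ring F s) = 0%N.
Proof.
by rewrite /lee_weight big1 // => i _; rewrite coef0 lee_weight_ring0.
Qed.

Lemma lee_weight_ring_basis (i : 'I_m) :
  lee_weight_ring b (qpolyC _ b`_i) = 1%N.
Proof.
rewrite /lee_weight_ring !coefC /= !addr0 lee_weight_field0.
by rewrite lee_weight_field_basis.
Qed.

Lemma lee_weight_ringX2_basis (i : 'I_m) :
  lee_weight_ring b ('qX ^+ 2 * qpolyC _ b`_i) = 2.
Proof.
rewrite /lee_weight_ring !coef_chain_ringX2M //= coefC /= !add0r.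
by rewrite lee_weight_field0 lee_weight_field_basis.
Qed.

(** The coefficients are binomials modulo 2, hence 0 or 1 in both rings: each entry is t or 0. *)
Lemma lee_weight_X1exp (s M : nat) (t : chain_ring F) : (M < 2 ^ s)%N ->
  lee_weight b (qpolyC _ t * (cyc_x F s + 1) ^+ M) =
  (lee_weight_ring b t * hamming_weight (2 ^ s) (('X + 1 : {poly F}) ^+ M))%N.
Proof.
move=> lt_M; rewrite -[qpolyC _ t]in_cyclic_ringK cyc_x_add1X -in_qpolyM.
rewrite /lee_weight /hamming_weight big_distrr; apply: eq_bigr => i _ /=.
rewrite Pdiv.CommonRing.rmodp_small; last first.
  rewrite cyclic_modulusE size_XnsubC ?expn_gt0 // ltnS mul_polyC.
  by rewrite (leq_trans (size_scale_leq _ _)) // size_X1exp.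
rewrite coefCM !coef_X1exp -(GRing.natr_mod_pchar pchar_F2ext 'C(M, i)).
rewrite -(GRing.natr_mod_pchar (pchar_chain_ring pchar_F2ext) 'C(M, i)) modn2.
case: odd; first by rewrite mulr1 oner_eq0 muln1.
by rewrite mulr0 eqxx muln0 lee_weight_ring0.
Qed.

(** The word attaining d is nonzero because its weight is positive. *)
Lemma lee_distanceP (s d : nat) (C : cyclic_ring F s -> Prop)
    (c : cyclic_ring F s) :
  (0 < d)%N -> C c -> lee_weight b c = d ->
  (forall c', C c' -> c' != 0 -> (d <= lee_weight b c')%N) ->
  is_lee_distance b C d.
Proof.
move=> d_gt0 Cc cd lower; split; last first.
  by move=> k [c' [Cc' c'0 ->]]; apply: lower.
exists c; split=> //; apply: contraTneq d_gt0 => c0.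
by rewrite -cd c0 lee_weight0.
Qed.

End LeeDistance.

(** * Membership of the words of minimum weight *)

Lemma mem_code_alpha (F : fieldType) (s alpha omega M : nat)
    (t : chain_ring F) :
  (alpha <= M)%N ->
  code_C61 F s alpha omega (qpolyC _ t * (cyc_x F s + 1) ^+ M).
Proof.
move=> le_M; exists (fun i : 'I_2 =>
  if i == 0%N :> nat then qpolyC _ t * (cyc_x F s + 1) ^+ (M - alpha) else 0).
by rewrite big_ord_recl big_ord1 /= mul0r addr0 -mulrA -exprD subnK.
Qed.

Lemma mem_code_omega (F : fieldType) (s alpha omega M : nat)
    (t : chain_ring F) :
  (omega <= M)%N ->
  code_C61 F s alpha omega (qpolyC _ ('qX ^+ 2 * t) * (cyc_x F s + 1) ^+ M).
Proof.
move=> le_M; exists (fun i : 'I_2 =>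
  if i == 0%N :> nat then 0 else qpolyC _ t * (cyc_x F s + 1) ^+ (M - omega)).
rewrite big_ord_recl big_ord1 /= mul0r add0r qpolyCM rmorphXn [RHS]mulrACA.
by rewrite -exprD subnK // [in RHS](mulrC (qpolyC _ t)).
Qed.

(** * The distance in the four cases *)

Theorem theorem3p22 (m s : nat) (F : fieldExtType 'F_2)
    (alpha omega U V : nat) (b : m.-tuple F)
    (m_gt0 : (0 < m)%N) (s_gt0 : (0 < s)%N)
    (dimF : \dim {:F} = m)
    (HU : is_U F s alpha U) (HV : is_V F s alpha V)
    (omega_lt_V : (omega < V)%N) (V_le_U : (V <= U)%N) (U_le_alpha : (U <= alpha)%N)
    (alpha_le : (alpha <= 2 ^ s - 1)%N)
    (b_tob : trace_orthogonal_basis b) :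
  [/\ (1 <= alpha <= 2 ^ (s - 1))%N ->
        is_lee_distance b (code_C61 F s alpha omega) 2,
      (2 ^ (s - 1) + 1 <= alpha <= 2 ^ s - 1)%N -> omega = 0%N ->
        is_lee_distance b (code_C61 F s alpha omega) 2,
      (2 ^ (s - 1) + 1 <= alpha <= 2 ^ s - 1)%N -> (1 <= omega <= 2 ^ (s - 1))%N ->
        is_lee_distance b (code_C61 F s alpha omega) 4
    & forall gamma : nat, (1 <= gamma <= s - 1)%N ->
        (2 ^ s - 2 ^ (s - gamma) + 1 <= omega)%N -> (omega < alpha)%N ->
        (alpha <= 2 ^ s - 2 ^ (s - gamma) + 2 ^ (s - gamma - 1))%N ->
        is_lee_distance b (code_C61 F s alpha omega) (2 ^ (gamma + 1))].
Proof.
have [b_basis _] := b_tob; have F2 := pchar_F2ext F.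
have lt_oa : (omega < alpha)%N.
  by rewrite (leq_trans omega_lt_V) // (leq_trans V_le_U).
have lt_alpha : (alpha < 2 ^ s)%N.
  by rewrite (leq_ltn_trans alpha_le) // ltn_subrL expn_gt0.
have le_oa : (omega <= alpha <= 2 ^ s)%N by apply/andP; split; apply: ltnW.
have half : (2 ^ s = 2 ^ (s - 1) + 2 ^ (s - 1))%N.
  by rewrite addnn -mul2n -expnS subn1 prednK.
have halfB : (2 ^ s - 2 ^ (s - 1) = 2 ^ (s - 1))%N by rewrite {1}half addnK.
pose i0 := Ordinal m_gt0; pose zeta := qpolyC ('X^3) b`_i0.
have wt_M k : (k <= s)%N -> (2 ^ s - 2 ^ (s - k) < 2 ^ s)%N.
  by move=> ks; rewrite ltn_subrL !expn_gt0.
have upper_alpha k : (k <= s)%N -> (alpha <= 2 ^ s - 2 ^ (s - k))%N ->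
    exists2 c, code_C61 F s alpha omega c & lee_weight b c = (2 ^ k)%N.
  move=> ks le_M.
  exists (qpolyC _ zeta * (cyc_x F s + 1) ^+ (2 ^ s - 2 ^ (s - k))).
    exact: mem_code_alpha.
  rewrite lee_weight_X1exp ?wt_M // lee_weight_ring_basis // mul1n.
  exact: hamming_weight_X1exp.
(* The factor u^2 doubles the weight, but only omega has to stay below the exponent. *)
have upper_omega k : (k <= s)%N -> (omega <= 2 ^ s - 2 ^ (s - k))%N ->
    exists2 c, code_C61 F s alpha omega c & lee_weight b c = (2 ^ k.+1)%N.
  move=> ks le_M.
  exists (qpolyC _ ('qX ^+ 2 * zeta) * (cyc_x F s + 1) ^+ (2 ^ s - 2 ^ (s - k))).
    exact: mem_code_omega.
  rewrite lee_weight_X1exp ?wt_M // lee_weight_ringX2_basis // expnS.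
  by rewrite hamming_weight_X1exp.
(* Multiples of (X + 1)^alpha have Hamming weight at least 2^(k+1); for (X + 1)^omega the bound 2^k
   is enough, being doubled. *)
have lower k l c : (k <= s)%N -> (2 ^ s - 2 ^ (s - k) < alpha)%N ->
    (forall f : {poly F}, f != 0 -> (size f <= 2 ^ s)%N ->
      ('X + 1) ^+ omega %| f -> (2 ^ l <= hamming_weight (2 ^ s) f)%N) ->
    (k <= l)%N -> code_C61 F s alpha omega c -> c != 0 ->
    (2 ^ k.+1 <= lee_weight b c)%N.
  move=> ks lt_M l_omega kl; apply: lee_weight_lower => // f f0 sf dv.
    exact: hamming_weight_lower ks lt_M f0 sf dv.
  by rewrite expnS leq_mul2l /= (leq_trans _ (l_omega _ f0 sf dv)) ?leq_exp2l.
have lower2 c : code_C61 F s alpha omega c -> c != 0 -> (2 <= lee_weight b c)%N.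
  apply: (lower 0 0)%N; rewrite ?subn0 ?subnn ?(leq_ltn_trans _ lt_oa) //.
  by move=> f f0 sf _; apply: hamming_weight_gt0.
split=> [/andP[_ le_alpha] | _ omega0 |
         /andP[gt_alpha _] /andP[omega_gt0 le_omega] |].
- have [//||c cC cd] := upper_alpha 1%N; first by rewrite halfB.
  exact: lee_distanceP cC cd lower2.
- have [//||c cC cd] := upper_omega 0%N; first by rewrite omega0.
  exact: lee_distanceP cC cd lower2.
- have [//||c cC cd] := upper_omega 1%N; first by rewrite halfB.
  apply: lee_distanceP cC cd _ => // c'; apply: (lower 1%N 1%N) => //.
    by rewrite halfB -addn1.
  (* With k = 0 the threshold is 0, and omega is positive. *)
  move=> f f0 sf; apply: (@hamming_weight_lower _ F2 s 0%N) => //.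
  by rewrite subn0 subnn.
move=> k /andP[k_gt0 le_k] gt_omega _ le_alpha.
have ks : (k < s)%N by rewrite (leq_ltn_trans le_k) // subn1 prednK.
rewrite addn1 in gt_omega; rewrite (addn1 k).
have [//||c cC cd] := upper_alpha k.+1.
  (* The upper bound on alpha is 2^s - 2^(s-(k+1)), as 2^(s-k) is twice 2^(s-(k+1)). *)
  apply: leq_trans le_alpha _; rewrite -subnDA addn1.
  have e : (2 ^ (s - k) = 2 ^ (s - k.+1) + 2 ^ (s - k.+1))%N.
    by rewrite addnn -mul2n -expnS -subSn.
  by rewrite e subnDA subnK // leq_subRL -?e ?leq_exp2l ?leq_subr //.
apply: lee_distanceP cC cd _ => //; first exact: expn_gt0.
(* Both omega and alpha exceed 2^s - 2^(s-k). *)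
move=> c'; apply: (lower k k.+1) => //; first exact: ltnW.
  exact: ltn_trans gt_omega lt_oa.
by move=> f; apply: hamming_weight_lower gt_omega => //; apply: ltnW.
Qed.
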